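(* Let $k\ge1$ be an integer. Let $L:\mathbb{T}^{d+1}\times\mathbb{R}^d\to\mathbb{R}$ be a $C^2$ function, strictly convex and superlinear in $v$ ($L(z,v)/|v|\to+\infty$ as $|v|\to+\infty$), and let $H:\mathbb{T}^{d+1}\times\mathbb{R}^d\to\mathbb{R}$ be its Legendre transform, where $H$ is smooth, $H_{pp}$ is positive definite, and $H(z,p)/|p|\to+\infty$ as $|p|\to+\infty$. Suppose that the equation $$\bigl(e^{k(u_t+H(z,\nabla u))}\bigr)_t+\operatorname{div}\bigl(e^{k(u_t+H(z,\nabla u))}H_p(z,\nabla u)\bigr)=0\quad\text{on }\mathbb{T}^{d+1}$$ has a smooth solution $u_k:\mathbb{T}^{d+1}\to\mathbb{R}$ with $\int_{\mathbb{T}^{d+1}}u_k=0$, and let $$m_k(z)=\frac{e^{k(u_{k,t}(z)+H(z,\nabla u_k(z)))}}{I_k[u_k]}.$$ Let $\mu_k$ be the probability measure on $\mathbb{T}^{d+1}\times\mathbb{R}^d$ given by $\mu_k(z,v)=\delta(v-H_p(z,\nabla u_k(z)))\,m_k(z)$, that is, $$\int_{\mathbb{T}^{d+1}\times\mathbb{R}^d}F(z,v)\,d\mu_k=\int_{\mathbb{T}^{d+1}}F(z,H_p(z,\nabla u_k(z)))\,m_k(z)\,dz$$ for all continuous $F:\mathbb{T}^{d+1}\times\mathbb{R}^d\to\mathbb{R}$. Then $\mu_k$ is a minimizer of $A_{L,k}$ on $\mathcal{C}$, and $u_k$ is a minimizer of $I_k$ among the functions $u\in C^1(\mathbb{T}^{d+1})$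 with $\int_{\mathbb{T}^{d+1}}u=0$.
   Context: $\mathbb{T}=\mathbb{R}/\mathbb{Z}$; points of $\mathbb{T}^{d+1}$ are written $z=(x,t)$ with $x\in\mathbb{T}^d$, $t\in\mathbb{T}$; $\nabla$ and $\operatorname{div}$ are taken in $x$ only, $u_t$ is the derivative in $t$. The Legendre transform is $H(z,p)=\sup_{v\in\mathbb{R}^d}(p\cdot v-L(z,v))$. For $u\in C^1(\mathbb{T}^{d+1})$, $$I_k[u]=\int_{\mathbb{T}^{d+1}}e^{k(u_t+H(x,t,\nabla u))}\,dx\,dt.$$ For a Borel probability measure $\mu$ on $\mathbb{T}^{d+1}\times\mathbb{R}^d$ let $m_\mu$ be its push-forward to $\mathbb{T}^{d+1}$ under $(z,v)\mapsto z$. For a Borel probability measure $m$ on $\mathbb{T}^{d+1}$ that is absolutely continuous with respect to Lebesgue measure (density also denoted $m$) put $S^*[m]=\int_{\mathbb{T}^{d+1}}m(z)\log m(z)\,dz\in(-\infty,+\infty]$. For an arbitrary Borel probability measure $m$ on $\mathbb{T}^{d+1}$ let $\bar S[m]$ be the infimum of $\liminf_n S^*[m_n]$ over all sequences of absolutely continuous probability measures $m_n$ converging weakly to $m$ (the lower semicontinuous convex extension of $S^*$; the value $+\infty$ is allowed). Put $S[\mu]=\bar S[m_\mu]$. Let $\mathcal{C}$ be the set of Borel probability measures $\mu$ on $\mathbb{T}^{d+1}\times\mathbb{R}^d$ such that (a) $\int|v|\,d\mu(z,v)<+\infty$ and (b) $\int(\varphi_t+\nabla\varphi\cdot v)\,d\mu(x,t,v)=0$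 for all $\varphi\in C^1(\mathbb{T}^{d+1})$. For $\mu\in\mathcal{C}$ put $A_{L,k}(\mu)=\int_{\mathbb{T}^{d+1}\times\mathbb{R}^d}L(z,v)\,d\mu+\frac1kS[\mu]\in(-\infty,+\infty]$. *)

(* Defs.v *)
From HB Require Import structures.
From mathcomp Require Import all_boot all_order all_algebra.
From mathcomp Require Import generic_quotient lra.
From mathcomp Require Import all_classical all_reals all_analysis measurable_realfun.

Set Implicit Arguments.
Unset Strict Implicit.
Unset Printing Implicit Defensive.

Import Order.TTheory GRing.Theory Num.Theory.
Import numFieldNormedType.Exports.

Local Open Scope classical_set_scope.
Local Open Scope ring_scope.

Notation borel T := (g_sigma_algebraType (@open T)).

(* Makes products of pointed topological spaces canonically pointed. *)
HB.instance Definition _ (S T : ptopologicalType) :=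
  Pointed.on (S * T)%type.

Lemma continuous_borel (S T : ptopologicalType) (f : S -> T) :
  continuous f -> measurable_fun setT (f : borel S -> borel T).
Proof.
move=> /continuousP cf; apply: (@measurability _ _ (borel S) (borel T) _ _ (@open T)) => //.
move=> _ [A oA <-]; rewrite setTI.
by apply: sub_sigma_algebra; exact: cf.
Qed.

Section torus.
Context {R : realType} {n : nat}.

Definition eqmodZ (x y : 'rV[R]_n) : bool :=
  [forall i, x 0 i - y 0 i \is a Num.int].

Lemma eqmodZ_refl : reflexive eqmodZ.
Proof. by move=> x; apply/forallP => i; rewrite subrr. Qed.

Lemma eqmodZ_sym : symmetric eqmodZ.
Proof.
by move=> x y; apply/forallP/forallP => xy i; rewrite -opprB rpredN.
Qed.

Lemma eqmodZ_trans : transitive eqmodZ.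
Proof.
move=> y x z /forallP xy /forallP yz; apply/forallP => i.
by rewrite -(subrKA (y 0 i)) rpredD.
Qed.

Canonical eqmodZ_equiv := EquivRel eqmodZ eqmodZ_refl eqmodZ_sym eqmodZ_trans.

End torus.

Definition torus (R : realType) (n : nat) : Type :=
  quotient_topology {eq_quot (@eqmodZ R n)}%qT.

HB.instance Definition _ (R : realType) (n : nat) :=
  PointedTopological.copy (torus R n)
    (quotient_topology {eq_quot (@eqmodZ R n)}%qT).
HB.instance Definition _ (R : realType) (n : nat) :=
  Quotient.copy (torus R n) (quotient_topology {eq_quot (@eqmodZ R n)}%qT).

Definition tproj {R : realType} {n : nat} (y : 'rV[R]_n) : torus R n :=
  (\pi y)%qT.

Lemma tproj_continuous (R : realType) (n : nat) : continuous (@tproj R n).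
Proof. exact: pi_continuous. Qed.

Definition borel_tproj {R : realType} {n : nat} :
  borel 'rV[R]_n -> borel (torus R n) := tproj.

HB.instance Definition _ (R : realType) (n : nat) :=
  isMeasurableFun.Build _ _ (borel 'rV[R]_n) (borel (torus R n)) borel_tproj
    (continuous_borel (@tproj_continuous R n)).

Definition row_cons {R : realType} {n : nat}
    (p : measurableTypeR R * borel 'rV[R]_n) : borel 'rV[R]_n.+1 :=
  row_mx (const_mx p.1 : 'rV_1) (p.2 : 'rV_n).

Lemma measurable_row_cons (R : realType) (n : nat) :
  measurable_fun setT (@row_cons R n).
Proof.
apply: (@measurability _ _ _ (borel 'rV[R]_n.+1) _ _ (@open 'rV[R]_n.+1)) => //.
move=> _ [U oU <-]; rewrite setTI.
pose box (q : rat * 'rV[rat]_n * nat) : set (R * 'rV[R]_n) :=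
  ball (ratr q.1.1 : R) (q.2.+1%:R^-1) `*`
  ball (map_mx ratr q.1.2 : 'rV[R]_n) (q.2.+1%:R^-1).
have -> : row_cons @^-1` U =
    \bigcup_(q in [set q | box q `<=` row_cons @^-1` U]) box q.
  apply/seteqP; split => [[x y]/= Uxy|xy [q qU qxy]]; last exact: qU.
  move: oU; rewrite openE => /(_ _ Uxy) /nbhs_ballP[e /= e0 eU].
  have [k] := ltr_add_invr (divr_gt0 e0 (ltr0n _ 2)); rewrite add0r => ke.
  set r : R := k.+1%:R^-1 in ke *.
  have r0 : 0 < r by rewrite invr_gt0.
  have rat_near (z : R) : {q : rat | ball (ratr q : R) r z}.
    apply: cid; have zr : z - r < z + r by lra.
    have [q] := rat_in_itvoo zr.
    rewrite in_itv/= => /andP[q1 q2]; exists q.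
    by rewrite /ball/= ltr_norml; apply/andP; split; lra.
  pose q := (sval (rat_near x), \row_j sval (rat_near (y 0 j)), k).
  exists q; last first.
    split => /=; first exact: (svalP (rat_near x)).
    by split => // i j; rewrite !mxE (ord1 i); exact: (svalP (rat_near (y 0 j))).
  move=> [x' y'] [/= xx' [_ yy']]; apply: eU; split => // i j.
  have tri (a b c : R) : ball c r a -> ball c r b -> ball a e b.
    rewrite /ball/= !ltr_norml => /andP[? ?] /andP[? ?].
    by apply/andP; split; lra.
  rewrite !mxE; case: fintype.splitP => l _; rewrite ?mxE.
    by apply: tri xx'; exact: (svalP (rat_near x)).
  apply: tri (yy' i l).
  by rewrite (ord1 i) !mxE; exact: (svalP (rat_near (y 0 l))).
rewrite bigcup_mkcond.
apply: countable_bigcupT_measurable => // q; case: ifPn => // _.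
by apply: measurableX; [exact: measurable_ball|
  apply: sub_sigma_algebra; exact: ball_open].
Qed.

HB.instance Definition _ (R : realType) (n : nat) :=
  isMeasurableFun.Build _ _ _ (borel 'rV[R]_n.+1) (@row_cons R n)
    (@measurable_row_cons R n).

(* Lebesgue measure on the unit cube [0,1]^n, as a measure on R^n. *)
Fixpoint cube_measure (R : realType) (n : nat) :
    probability (borel 'rV[R]_n) R :=
  match n with
  | 0 => @dirac _ (borel 'rV[R]_0) (0 : 'rV[R]_0) R
  | n'.+1 => distribution (uniform_prob (@ltr01 R) \x cube_measure R n')%E
               row_cons
  end.

(* The image of Lebesgue measure on [0,1]^n under R^n -> R^n/Z^n; the faces of
   the cube, where the projection is not injective, are null sets. *)
Definition torus_measure (R : realType) (n : nat) :
    probability (borel (torus R n)) R :=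
  distribution (cube_measure R n) borel_tproj.

(* For finite-dimensional [V], and only there, this is the usual class C^k. *)
Fixpoint is_C {R : realType} {V : normedModType R} (k : nat) (f : V -> R)
    : Prop :=
  match k with
  | 0 => continuous f
  | k'.+1 => (forall x, differentiable f x) /\ forall v, is_C k' ('D_v f)
  end.

Definition torus_C {R : realType} {n : nat} (k : nat) (f : torus R n -> R) :=
  is_C k (f \o tproj).

Definition phase_C {R : realType} {n d : nat} (k : nat)
    (f : torus R n * 'rV[R]_d -> R) :=
  is_C k (fun y : 'rV[R]_n * 'rV[R]_d => f (tproj y.1, y.2)).

(* The value does not depend on the representative, since [f \o tproj] is
   Z^n-periodic. *)
Definition pderiv {R : realType} {n : nat} (i : 'I_n) (f : torus R n -> R)
    (z : torus R n) : R :=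
  'D_(delta_mx 0 i) (f \o tproj) (repr z).

Definition grad {R : realType} {d : nat} (f : 'rV[R]_d -> R) (p : 'rV[R]_d)
    : 'rV[R]_d :=
  \row_i 'D_(delta_mx 0 i) f p.

Definition hess {R : realType} {d : nat} (f : 'rV[R]_d -> R) (p : 'rV[R]_d)
    : 'M[R]_d :=
  \matrix_(i, j) 'D_(delta_mx 0 i) ('D_(delta_mx 0 j) f) p.

Definition posdef {R : realType} {d : nat} (A : 'M[R]_d) :=
  forall x : 'rV[R]_d, x != 0 -> 0 < (x *m A *m x^T) 0 0.

Definition dotv {R : realType} {d : nat} (p v : 'rV[R]_d) : R :=
  \sum_i p 0 i * v 0 i.

(* The library norm on ['rV_d] is the sup norm. *)
Definition enorm {R : realType} {d : nat} (v : 'rV[R]_d) : R :=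
  Num.sqrt (dotv v v).

Definition strictly_convex {R : realType} {d : nat} (f : 'rV[R]_d -> R) :=
  forall (v w : 'rV[R]_d) (s : R), v != w -> 0 < s < 1 ->
    f (s *: v + (1 - s) *: w) < s * f v + (1 - s) * f w.

Definition superlinear {R : realType} {d : nat} (f : 'rV[R]_d -> R) :=
  forall M : R, exists r : R, forall v, r < enorm v -> M < f v / enorm v.

Definition is_minimizer {T : Type} {disp : Order.disp_t} {S : porderType disp}
    (D : set T) (f : T -> S) (x : T) :=
  D x /\ forall y, D y -> (f x <= f y)%O.

Section entropy.
Local Open Scope charge_scope.
Context {R : realType} {n : nat}.
Local Notation pmeasure := (probability (borel (torus R n)) R).

(* [ln 0 = 0] in the library, so the integrand is 0 where the density is 0. *)
Definition entropy (m : pmeasure) : \bar R :=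
  let rho z := fine
    (('d (charge_of_finite_measure m) '/d (torus_measure R n)) z) in
  (\int[torus_measure R n]_z (rho z * ln (rho z))%:E)%E.

Definition weak_cvg (mn : nat -> pmeasure) (m : pmeasure) :=
  forall f : torus R n -> R, continuous f ->
    (\int[mn j]_z (f z)%:E)%E @[j --> \oo] --> (\int[m]_z (f z)%:E)%E.

Definition entropy_lsc (m : pmeasure) : \bar R :=
  ereal_inf [set s | exists mn : nat -> pmeasure,
    [/\ forall j, mn j `<< torus_measure R n, weak_cvg mn m &
        s = limn_einf (entropy \o mn)]].

End entropy.

Section problems.
Context {R : realType} {d : nat}.
Local Notation space := (torus R d.+1).
Local Notation phase := (torus R d.+1 * 'rV[R]_d)%type.
Local Notation dz := (torus_measure R d.+1).

(* In [z = (x, t)] the time [t] is the last of the d+1 coordinates. *)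
Definition dt (u : space -> R) (z : space) : R := pderiv ord_max u z.

Definition gradx (u : space -> R) (z : space) : 'rV[R]_d :=
  \row_i pderiv (lift ord_max i) u z.

Definition divx (F : space -> 'rV[R]_d) (z : space) : R :=
  \sum_i pderiv (lift ord_max i) (fun y => F y 0 i) z.

Definition legendre (L : phase -> R) (zp : phase) : \bar R :=
  ereal_sup [set (dotv zp.2 v - L (zp.1, v))%:E | v in [set: 'rV[R]_d]].

Definition Hp (H : phase -> R) (z : space) : 'rV[R]_d -> 'rV[R]_d :=
  grad (fun p => H (z, p)).

Definition Hpp (H : phase -> R) (z : space) : 'rV[R]_d -> 'M[R]_d :=
  hess (fun p => H (z, p)).

Definition expH (H : phase -> R) (k : nat) (u : space -> R) (z : space) : R :=
  expR (k%:R * (dt u z + H (z, gradx u z))).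

Definition I_ (H : phase -> R) (k : nat) (u : space -> R) : R :=
  \int[dz]_z expH H k u z.

Definition C1_mean0 : set (space -> R) :=
  [set u | torus_C 1 u /\ \int[dz]_z u z = 0].

Definition base (zv : borel phase) : borel space := zv.1.

Lemma measurable_base : measurable_fun setT base.
Proof.
apply: (@continuous_borel _ _ (fst : phase -> space)) => x; exact: cvg_fst.
Qed.

HB.instance Definition _ :=
  isMeasurableFun.Build _ _ (borel phase) (borel space) base measurable_base.

Definition holonomic : set (probability (borel phase) R) :=
  [set mu : probability (borel phase) R | (\int[mu]_zv (enorm zv.2)%:E < +oo)%E /\
    forall phi : space -> R, torus_C 1 phi ->
      (\int[mu]_zv (dt phi zv.1 + dotv (gradx phi zv.1) zv.2)%:E = 0)%E].

(* The sum is never of the form oo - oo: [entropy_lsc] is nonnegative because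
   [torus_measure] is a probability, and the integral is above -oo when [L] is
   convex, continuous and superlinear. *)
Definition action (L : phase -> R) (k : nat) (mu : probability (borel phase) R)
    : \bar R :=
  (\int[mu]_zv (L zv)%:E
   + (k%:R^-1)%:E * entropy_lsc (distribution mu base))%E.

(* [mu(z,v) = delta(v - V(z)) m(z)] *)
Definition graph_measure (V : space -> 'rV[R]_d) (m : space -> R)
    (mu : probability (borel phase) R) :=
  forall F : phase -> R, continuous F ->
    (\int[mu]_zv (F zv)%:E = \int[dz]_z (F (z, V z) * m z)%:E)%E.

End problems.

(* Main.v *)
Require Import Defs.
From HB Require Import structures.
From mathcomp Require Import all_boot all_order all_algebra.
From mathcomp Require Import generic_quotient lra ring.
From mathcomp Require Import all_classical all_reals all_analysis.
From mathcomp Require Import measurable_realfun.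

Set Implicit Arguments.
Unset Strict Implicit.
Unset Printing Implicit Defensive.

Import Order.TTheory GRing.Theory Num.Theory.
Import numFieldNormedType.Exports.

Local Open Scope classical_set_scope.
Local Open Scope ring_scope.

(** Write [Z = u_t + H (z, grad u)] and [V = H_p (z, grad u)] for the solution
    [u = u_k], so that the density is [m = expR (k Z) / I] with [I = I_k [u]].

    Legendre duality enters through two facts, [fenchel_ineq] and [fenchel_eq]:
    [p.v - L (z, v) <= H (z, p)], with equality at [v = H_p (z, p)]. Together
    they give the tangent inequality [H_tangent] for [H (z, _)]. The equation
    enters only in its weak form [current_weak]: the current [m (1, V)] is
    orthogonal to the space-time gradient of every C^1 function. It follows by
    integrating by parts on the torus ([torus_integral_pderiv]), which on the
    unit cube is Fubini's theorem, the fundamental theorem of calculus in one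
    coordinate, and periodicity ([cube_derive0]).

    Minimality of [u]: by the tangent inequalities for [expR] and [H (z, _)],
    [I_k [w] - I_k [u]] is at least [k] times the integral of
    [expR (k Z) ((w - u)_t + grad (w - u) . V)], which vanishes by the weak
    form ([I_minimal]).

    Minimality of the graph measure: its action and the infimum are both the
    number [- ln I / k]. For holonomic [mu], the Fenchel inequality gives
    [L (z, v) >= grad u . v - H (z, grad u) = (u_t + grad u . v) - Z], whose
    first bracket integrates to [0]. Gibbs' inequality [entropy_ge], that the
    entropy of a measure is at least its integral of [ln m], survives weak
    limits because [ln m] is continuous ([entropy_lsc_ge]); so the entropy term
    is at least the integral of [ln m / k = Z - ln I / k], and the two integrals
    of [Z] cancel ([action_ge]). On the graph measure Fenchel's inequality is an
    equality, and the relaxed entropy is at most that of the density [m]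
    itself, so the same computation bounds its action from above
    ([action_graph]). *)

(** * The torus as a quotient *)

Section torus_topology.
Context {R : realType} {n : nat}.
Implicit Types (x y m : 'rV[R]_n) (z : torus R n).

Lemma tprojP x y :
  reflect (tproj x = tproj y) [forall i, x 0 i - y 0 i \is a Num.int].
Proof. by apply: (iffP idP) => [xy|/eqmodP//]; exact/eqmodP. Qed.

Lemma tprojDz y m : (forall i, m 0 i \is a Num.int) -> tproj (y + m) = tproj y.
Proof.
by move=> mZ; apply/tprojP/forallP => i; rewrite !mxE (addrC (y 0 i)) addrK.
Qed.

Lemma tproj_repr z : tproj (repr z) = z.
Proof. exact: reprK. Qed.

Lemma torus_continuous (T : topologicalType) (f : torus R n -> T) :
  continuous (f \o tproj) -> continuous f.
Proof. by move=> cf; apply/quotient_continuous. Qed.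

(** The saturation of an open set is the union of its integer translates. *)
Lemma tproj_open (U : set 'rV[R]_n) : open U -> open (tproj @` U).
Proof.
move=> oU; rewrite /open/= /quotient_open.
rewrite [X in open X](_ : _ =
    \bigcup_(m in [set m : 'rV[R]_n | forall i, m 0 i \is a Num.int])
      ((fun y => y + m) @^-1` U)).
  apply: bigcup_open => m _.
  have cm : continuous (fun y : 'rV[R]_n => y + m).
    by move=> y; exact: (cvgD cvg_id (cvg_cst _)).
  by move/continuousP: cm; exact.
apply/seteqP; split => [y [x Ux /tprojP/forallP xy]|y [m mZ Uym]].
  exists (x - y) => /=; first by move=> i; rewrite !mxE.
  by rewrite addrC subrK.
by exists (y + m) => //; exact: tprojDz.
Qed.

Lemma torus_compact : compact [set: torus R n].
Proof.
pose Q := [set y : 'rV[R]_n | forall i, `[0, 1]%classic (y ord0 i)].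
have cQ : compact Q.
  exact: (@rV_compact R n (fun=> `[0, 1]%classic) (fun=> @segment_compact R 0 1)).
have -> : [set: torus R n] = tproj @` Q.
  apply/seteqP; split => // z _.
  pose m : 'rV[R]_n := \row_i - (Num.floor (repr z 0 i))%:~R.
  exists (repr z + m); last first.
    rewrite tprojDz ?tproj_repr// => i.
    by rewrite mxE rpredN intr_int.
  move=> i /=; rewrite !mxE in_itv/= subr_ge0 lerBlDr addrC floor_le.
  by have := floorD1_gt (repr z 0 i); rewrite intrD => /ltW.
by apply: continuous_compact cQ; apply: continuous_subspaceT;
  exact: tproj_continuous.
Qed.

Lemma torus_bounded (f : torus R n -> R) : continuous f ->
  exists M, forall z, `|f z| <= M.
Proof.
move=> cf.
have cnf : continuous (fun z => `|f z|) by move=> z; exact: (cvg_norm (cf z)).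
have [||M _ fM] := @compact_EVT_max _ R (fun z => `|f z|) [set: torus R n] _ torus_compact.
- by exists point.
- exact: continuous_subspaceT.
- by exists `|f M| => z; apply: fM; rewrite inE.
Qed.

End torus_topology.

(** Since [tproj] is open, so is its product with the identity of the velocity
    space; hence continuity descends from the lift. *)
Lemma phase_continuous (R : realType) (n d : nat) (T : topologicalType)
    (F : torus R n * 'rV[R]_d -> T) :
  continuous (fun y : 'rV[R]_n * 'rV[R]_d => F (tproj y.1, y.2)) ->
  continuous F.
Proof.
move=> cF [z v] A /= FA.
have := cF (repr z, v); rewrite /continuous_at/= tproj_repr => /(_ A FA).
case=> -[B C] /= [+ vC] BCA; rewrite nbhsE => -[U [oU Uz] UB].
exists (tproj @` U, C) => /=.
  split => //; apply: open_nbhs_nbhs; split; first exact: tproj_open.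
  by exists (repr z) => //; exact: tproj_repr.
by move=> [_ w] [/= [y Uy <-] Cw]; apply: (BCA (y, w)); split => //; exact: UB.
Qed.

Section torus_derivative.
Context {R : realType} {n : nat}.

(** A partial derivative on the torus is the derivative of the periodic lift,
    at any representative and not only at the one chosen in its definition. *)
Lemma derive_tproj (f : torus R n -> R) (v x y : 'rV[R]_n) :
  tproj x = tproj y -> 'D_v (f \o tproj) x = 'D_v (f \o tproj) y.
Proof.
move=> /tprojP/forallP xy.
have E h : f (tproj (h + x)) = f (tproj (h + y)).
  have -> : h + x = h + y + (x - y) by rewrite -addrA [y + _]addrC subrK.
  by rewrite tprojDz// => i; rewrite !mxE.
have E0 := E 0; rewrite !add0r in E0.
by rewrite /derive/= E0; under eq_fun do rewrite E.
Qed.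

Lemma pderivE (f : torus R n -> R) (i : 'I_n) :
  pderiv i f \o tproj = 'D_(delta_mx 0 i) (f \o tproj).
Proof.
by apply/funext => y; apply: derive_tproj; rewrite tproj_repr.
Qed.

End torus_derivative.

(** * Functions with values in a space of row vectors *)

Lemma continuous_row (R : realType) (T : topologicalType) (n : nat)
    (h : T -> 'rV[R]_n) :
  (forall i, continuous (fun x => h x 0 i)) -> continuous h.
Proof.
move=> ch x; apply/cvg_ballP => e e0.
have : \forall y \near x, forall i, ball (h x 0 i) e (h y 0 i).
  by apply: filter_forall => k; have /cvg_ballP := ch k x; apply.
by apply: filterS => y hy; split => // i j; rewrite (ord1 i).
Qed.

Lemma continuous_pair (S T U : topologicalType) (f : S -> T) (g : S -> U) :
  continuous f -> continuous g -> continuous (fun x => (f x, g x)).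
Proof.
move=> cf cg x; apply: (@cvg_pair _ _ _ _ (nbhs (f x)) (nbhs (g x))).
  exact: cf.
exact: cg.
Qed.

(** A map [g] that carries the line of direction [w] at [x] to the line of
    direction [v] at [g x], with the same parameter, leaves the difference
    quotients unchanged. *)
Lemma is_derive_line (R : numFieldType) (V W U : normedModType R) (f : V -> U)
    (g : W -> V) (x w : W) (v : V) (df : U) :
  (forall h, g (h *: w + x) = h *: v + g x) ->
  is_derive (g x) v f df -> is_derive x w (f \o g) df.
Proof.
move=> gE [dfx fE].
have E : (fun h => h^-1 *: (((f \o g) \o shift x) (h *: w) - (f \o g) x)) =
    (fun h => h^-1 *: ((f \o shift (g x)) (h *: v) - f (g x))).
  by apply/funext => h /=; rewrite gE.
by apply: DeriveDef; rewrite /derivable /derive E.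
Qed.

Section row_cons.
Context {R : realType} {n : nat}.
Implicit Types (x h : R) (y : 'rV[R]_n) (i : 'I_n).

Lemma row_cons0 x y : row_cons (x, y) 0 0 = x.
Proof.
rewrite mxE; case: fintype.splitP => j /= j0; first by rewrite mxE.
by [].
Qed.

Lemma row_consS x y i : row_cons (x, y) 0 (lift 0 i) = y 0 i.
Proof.
rewrite mxE; case: fintype.splitP => j /= ij.
  by move: (ltn_ord j); rewrite -ij.
by congr (y _ _); apply: val_inj; case: ij.
Qed.

Lemma rV_lineE k h (i j : 'I_k) (y : 'rV[R]_k) :
  (h *: delta_mx 0 i + y) 0 j = h * (j == i)%:R + y 0 j.
Proof. by rewrite !mxE. Qed.

Lemma row_cons_line x h y :
  row_cons (h + x, y) = h *: delta_mx 0 0 + row_cons (x, y).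
Proof.
apply/rowP => j; rewrite rV_lineE.
have [i ->|->] := unliftP 0 j; first by rewrite !row_consS mulr0 add0r.
by rewrite !row_cons0 mulr1.
Qed.

Lemma row_cons_lift x h i y :
  row_cons (x, h *: delta_mx 0 i + y) =
  h *: delta_mx 0 (lift 0 i) + row_cons (x, y).
Proof.
apply/rowP => j; rewrite rV_lineE.
have [k ->|->] := unliftP 0 j; last by rewrite !row_cons0 mulr0 add0r.
by rewrite !row_consS rV_lineE (inj_eq lift_inj).
Qed.

Lemma continuous_row_consl y : continuous (fun x => row_cons (x, y)).
Proof.
apply: continuous_row => j; have [i ->|->] := unliftP 0 j.
  by under eq_fun do rewrite row_consS; exact: cst_continuous.
by under eq_fun do rewrite row_cons0; move=> x; exact: cvg_id.
Qed.

Lemma continuous_row_consr x : continuous (fun y => row_cons (x, y)).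
Proof.
apply: continuous_row => j; have [i ->|->] := unliftP 0 j.
  by under eq_fun do rewrite row_consS; exact: coord_continuous.
by under eq_fun do rewrite row_cons0; exact: cst_continuous.
Qed.

End row_cons.

(** * Integrals of continuous functions *)

Lemma continuous_measurable (R : realType) (T : ptopologicalType) (f : T -> R) :
  continuous f -> measurable_fun setT (f : borel T -> R).
Proof.
move=> /continuousP cf; apply: (measurability _ (RGenOpens.measurableE R)) => //.
move=> _ [_ [a [b ->] <-]]; rewrite setTI.
by apply: sub_sigma_algebra; apply: cf; exact: interval_open.
Qed.

Lemma bounded_integrable d (T : measurableType d) (R : realType)
    (P : probability T R) (f : T -> R) (M : R) :
  measurable_fun setT f -> (forall x, `|f x| <= M) ->
  P.-integrable setT (EFin \o f).
Proof.
move=> mf fM; apply: measurable_bounded_integrable => //.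
  by rewrite -ge0_fin_numE// fin_num_measure.
by exists M; split; [exact: num_real|move=> r Mr x _; exact: le_trans (fM x) (ltW Mr)].
Qed.

Section cube_integral.
Context {R : realType}.
Local Notation mu := (@lebesgue_measure R).

Lemma uniform_derive0 (F G : R -> R) (M : R) :
  continuous G -> (forall x, `|G x| <= M) ->
  (forall x : R, is_derive x 1 F (G x)) -> F 1 = F 0 ->
  (\int[uniform_prob (@ltr01 R)]_x (G x)%:E = 0)%E.
Proof.
(* The uniform law is first compared with Lebesgue measure on nonnegative
   functions, hence the shift of [G] by its bound [M]. *)
move=> cG GM dF F10.
pose U : probability (measurableTypeR R) R := uniform_prob (@ltr01 R).
change (\int[U]_x (G x)%:E = 0)%E.
have mG : measurable_fun setT G by exact: continuous_measurable_fun.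
have iG : U.-integrable setT (EFin \o G) by exact: (@bounded_integrable _ _ _ U G M).
have dFM (x : R) : is_derive x 1 (fun x => F x + M * x) (G x + M).
  have dFx := dF x.
  by apply: is_derive_eq; rewrite [_ *: _]mulr1.
have cGM : continuous (fun x => G x + M).
  by move=> x; exact: (cvgD (cG x) (cvg_cst _)).
have E1 : (\int[U]_x (G x + M)%:E = M%:E)%E.
  rewrite integral_uniform//=; last 2 first.
  - by apply/measurable_EFinP; exact: measurable_funD.
  - by move=> x; rewrite lee_fin -lerBlDr sub0r; have := GM x; rewrite ler_norml => /andP[].
  rewrite subr0 invr1 mul1e.
  rewrite (@continuous_FTC2 _ _ (fun x => F x + M * x)) ?ltr01//.
  - by rewrite -EFinB F10; congr (_%:E); ring.
  - exact: continuous_subspaceT.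
  - have cF : continuous (fun x => F x + M * x).
      by move=> x; apply: differentiable_continuous; apply/derivable1_diffP.
    split; [by move=> x _; exact: ex_derive|exact: cvg_at_right_filter (cF 0)|
      exact: cvg_at_left_filter (cF 1)].
  - by move=> x _; rewrite derive1E derive_val.
move: E1; under eq_integral do rewrite EFinD.
rewrite integralD//; last exact: finite_measure_integrable_cst.
rewrite integral_cst//= [X in (_ * X)%E](_ : _ = 1%E); last exact: probability_setT.
rewrite mule1.
have /fineK <- : (\int[U]_x (G x)%:E)%E \is a fin_num by exact: integrable_fin_num.
by move=> -[E1]; congr (_%:E); lra.
Qed.

(** Along the first coordinate this is the fundamental theorem of calculus on
    each line, and along any other one the slices of the cube are cubes of
    smaller dimension; Fubini's theorem integrates either case. *)
Lemma cube_derive0 n (i : 'I_n) (F G : 'rV[R]_n -> R) (M : R) :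
  continuous G -> (forall y, `|G y| <= M) ->
  (forall y, is_derive y (delta_mx 0 i) F (G y)) ->
  (forall y, F (delta_mx 0 i + y) = F y) ->
  (\int[cube_measure R n]_y (G y)%:E = 0)%E.
Proof.
elim: n i F G => [[]//|n IH] i F G cG GM dF perF.
have mG := continuous_measurable cG.
pose U : probability (measurableTypeR R) R := uniform_prob (@ltr01 R).
have iG : (U \x cube_measure R n)%E.-integrable setT (EFin \o (G \o row_cons)).
  apply: (@bounded_integrable _ _ _ (U \x cube_measure R n)%E _ M) => [|x]; last exact: GM.
  exact: measurableT_comp.
rewrite [LHS]integral_distribution//; last exact/measurable_EFinP.
change (\int[(U \x cube_measure R n)%E]_p (G (row_cons p))%:E = 0)%E.
have [j i0|i0] := unliftP 0 i.
  rewrite -(integral12_prod_meas1 iG) integral0_eq// => x _.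
  apply: (IH j (fun y => F (row_cons (x, y))) (fun y => G (row_cons (x, y)))).
  - move=> y; apply: continuous_comp; last exact: cG.
    exact: continuous_row_consr.
  - by move=> y; exact: GM.
  - move=> y; apply: (@is_derive_line _ _ _ _ F (fun y => row_cons (x, y))).
    by move=> h; rewrite i0; exact: row_cons_lift.
  - by move=> y; rewrite -[in LHS](scale1r (delta_mx _ _)) row_cons_lift scale1r -i0.
rewrite -(integral21_prod_meas1 iG) integral0_eq// => y _.
apply: (@uniform_derive0 (fun x => F (row_cons (x, y))) (fun x => G (row_cons (x, y))) M).
- move=> x; apply: continuous_comp; last exact: cG.
  exact: continuous_row_consl.
- by move=> x; exact: GM.
- move=> x; apply: (@is_derive_line _ _ _ _ F (fun x => row_cons (x, y)) x 1 (delta_mx 0 0)).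
    by move=> h; rewrite [_ *: 1]mulr1 row_cons_line.
  by rewrite -i0; exact: dF.
- by rewrite -[X in F (row_cons (X, _)) = _]addr0 row_cons_line scale1r -i0.
Qed.
End cube_integral.

(** * Calculus of continuously differentiable functions *)

Section continuous_real.
Context {R : realType} {T : topologicalType}.
Implicit Types f g : T -> R.

Lemma continuous_add f g :
  continuous f -> continuous g -> continuous (fun x => f x + g x).
Proof. by move=> cf cg x; exact: cvgD (cf x) (cg x). Qed.

Lemma continuous_mul f g :
  continuous f -> continuous g -> continuous (fun x => f x * g x).
Proof. by move=> cf cg x; exact: cvgM (cf x) (cg x). Qed.

Lemma continuous_sum n (F : 'I_n -> T -> R) :
  (forall i, continuous (F i)) -> continuous (fun x => \sum_(i < n) F i x).
Proof.
by move=> cF x; apply: cvg_big => [|i _]; [exact: add_continuous|exact: cF].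
Qed.

End continuous_real.

Section C1.
Context {R : realType} {V : normedModType R}.
Implicit Types f g : V -> R.

Lemma is_C_continuous k f : is_C k f -> continuous f.
Proof.
by case: k => [//|k] [df _] x; exact: differentiable_continuous.
Qed.

Lemma is_CW k f : is_C k.+1 f -> is_C k f.
Proof.
elim: k f => [|k IH] f; first exact: is_C_continuous.
by move=> [df Cf]; split => // v; exact: IH (Cf v).
Qed.

Lemma is_C1_cst (c : R) : is_C 1 (cst c : V -> R).
Proof.
split=> [x|v]; first exact: differentiable_cst.
rewrite /= (_ : 'D_v (cst c) = cst 0); first exact: cst_continuous.
by apply/funext => x; rewrite derive_cst.
Qed.

Lemma is_C1D f g : is_C 1 f -> is_C 1 g -> is_C 1 (fun x => f x + g x).
Proof.
move=> [df cf] [dg cg]; split=> [x|v]; first exact: differentiableD.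
rewrite /= (_ : 'D_v _ = (fun x => 'D_v f x + 'D_v g x)).
  exact: continuous_add.
by apply/funext => x; rewrite deriveD//; exact: diff_derivable.
Qed.

Lemma deriveM_diff f g v x : differentiable f x -> differentiable g x ->
  'D_v (fun y => f y * g y) x = f x * 'D_v g x + g x * 'D_v f x.
Proof. by move=> df dg; rewrite deriveM//; exact: diff_derivable. Qed.

Lemma is_C1M f g : is_C 1 f -> is_C 1 g -> is_C 1 (fun x => f x * g x).
Proof.
move=> Cf Cg; have [df cf] := Cf; have [dg cg] := Cg.
have c_f := is_C_continuous Cf; have c_g := is_C_continuous Cg.
split=> [x|v]; first exact: differentiableM.
rewrite /= (_ : 'D_v _ = (fun x => f x * 'D_v g x + g x * 'D_v f x)).
  by apply: continuous_add; exact: continuous_mul.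
by apply/funext => x; exact: deriveM_diff.
Qed.

Lemma is_C1_expR f : is_C 1 f -> is_C 1 (expR \o f).
Proof.
move=> Cf; have [df cf] := Cf; have c_f := is_C_continuous Cf.
have dexp x : differentiable (@expR R) x by apply/derivable1_diffP.
split=> [x|v]; first exact: differentiable_comp.
rewrite /= (_ : 'D_v _ = (fun x => 'D_v f x * expR (f x))).
  apply: continuous_mul => // x.
  by apply: continuous_comp (c_f x) _; exact: continuous_expR.
apply/funext => x; rewrite !deriveE//; last exact: differentiable_comp.
by rewrite diff_comp//= diff1E// derive1E derive_val.
Qed.

Lemma row_deltaE n (h : V -> 'rV[R]_n) :
  h = \sum_(i < n) (fun x => h x 0 i *: delta_mx 0 i).
Proof.
by apply/funext => x; rewrite fct_sumE {1}(row_sum_delta (h x)).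
Qed.

Lemma differentiable_row n (h : V -> 'rV[R]_n) x :
  (forall i, differentiable (fun y => h y 0 i) x) -> differentiable h x.
Proof.
move=> dh; rewrite (row_deltaE h); apply: differentiable_sum => i.
exact: differentiableZl.
Qed.

(** The chain rule through the pair of the identity and [h]. The partial
    derivatives of [f] are continuous one direction at a time, so the
    differential of [f] has to be expanded on the coordinates of the moving
    direction ['D_v h]. *)
Lemma is_C1_comp d (f : V * 'rV[R]_d -> R) (h : V -> 'rV[R]_d) :
  is_C 1 f -> (forall i, is_C 1 (fun x => h x 0 i)) ->
  is_C 1 (fun x => f (x, h x)).
Proof.
move=> [df cf] Ch.
have dh x : differentiable h x by apply: differentiable_row => i; case: (Ch i).
have c_h : continuous h by apply: continuous_row => i; exact: is_C_continuous (Ch i).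
have dp x : differentiable (fun y => (y, h y)) x by exact: differentiable_pair.
have cp : continuous (fun y => (y, h y)).
  by move=> x; exact: differentiable_continuous.
split=> [x|v]; first exact: (differentiable_comp (dp x)).
rewrite /= (_ : 'D_v _ = (fun x => 'D_(v, 0) f (x, h x) +
    \sum_(i < d) 'D_v (fun x => h x 0 i) x * 'D_(0, delta_mx 0 i) f (x, h x))).
  have cpf w : continuous (fun x => 'D_w f (x, h x)).
    by move=> x; exact: continuous_comp (cp x) (cf w _).
  apply: continuous_add => //; apply: continuous_sum => i.
  by apply: continuous_mul => //; case: (Ch i) => _; exact.
apply/funext => x; rewrite deriveE; last exact: (differentiable_comp (dp x)).
rewrite (diff_comp (dp x))//= diff_pair//= (diff_val (f := id)).
have hE i : 'D_v (fun x => h x 0 i) x = 'd h x v 0 i.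
  by rewrite -deriveE// derive_mx ?mxE//; exact: diff_derivable.
have addE (a : V * 'rV[R]_d) b c : a + (b, c) = (a.1 + b, a.2 + c) by [].
have lin (w : 'rV[R]_d) : 'd f (x, h x) (0, w) =
    \sum_(i < d) w 0 i * 'd f (x, h x) (0, delta_mx 0 i).
  rewrite {1}(row_sum_delta w).
  rewrite (big_morph (fun w => 'd f (x, h x) (0, w)) (id1 := 0) (op1 := +%R)).
  - apply: eq_bigr => i _; rewrite -[_ * _]linearZ; congr ('d f _ _).
    by congr pair; rewrite scaler0.
  - by move=> a b; rewrite -linearD addE /= addr0.
  - exact: (linear0 ('d f (x, h x))).
have -> : (v, 'd h x v) = (v, 0) + (0, 'd h x v) by rewrite addE /= addr0 add0r.
rewrite linearD [X in _ + X]lin [in RHS]deriveE//; congr (_ + _).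
by apply: eq_bigr => i _; rewrite hE deriveE.
Qed.
End C1.

(** * Integration by parts on the torus *)

Section torus_calculus.
Context {R : realType} {n : nat}.
Implicit Types f g : torus R n -> R.

Lemma torus_C_continuous k f : torus_C k f -> continuous f.
Proof. by move=> Cf; apply: torus_continuous; exact: is_C_continuous Cf. Qed.

Lemma torus_CW k f : torus_C k.+1 f -> torus_C k f.
Proof. exact: is_CW. Qed.

Lemma pderiv_C k i f : torus_C k.+1 f -> torus_C k (pderiv i f).
Proof. by move=> [_ Cf]; rewrite /torus_C pderivE; exact: Cf. Qed.

Lemma torus_C1M f g :
  torus_C 1 f -> torus_C 1 g -> torus_C 1 (fun z => f z * g z).
Proof. exact: is_C1M. Qed.

Lemma pderivM i f g z : torus_C 1 f -> torus_C 1 g ->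
  pderiv i (fun z => f z * g z) z = f z * pderiv i g z + g z * pderiv i f z.
Proof.
by move=> [df _] [dg _]; rewrite /pderiv deriveM_diff//= tproj_repr.
Qed.

Lemma torus_integrable (P : probability (borel (torus R n)) R) f :
  continuous f -> P.-integrable setT (EFin \o f).
Proof.
move=> cf; have [M fM] := torus_bounded cf.
by apply: (@bounded_integrable _ _ _ P f M) => //; exact: continuous_measurable.
Qed.

Lemma torus_integral_pderiv i f : torus_C 1 f ->
  (\int[torus_measure R n]_z (pderiv i f z)%:E = 0)%E.
Proof.
move=> Cf; have c_df := torus_C_continuous (pderiv_C i Cf).
have [M dfM] := torus_bounded c_df.
have c_dF : continuous (pderiv i f \o tproj).
  by rewrite pderivE; case: Cf => _; exact.
rewrite integral_distribution//=; last 2 first.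
- by apply/measurable_EFinP; exact: continuous_measurable.
- apply: (@bounded_integrable _ _ _ (cube_measure R n) (pderiv i f \o tproj) M).
    exact: continuous_measurable.
  by move=> y; exact: dfM.
apply: (@cube_derive0 _ _ i (f \o tproj) (pderiv i f \o tproj) M) => //.
- by move=> y; exact: dfM.
- move=> y; rewrite pderivE; apply: DeriveDef => //.
  by apply: diff_derivable; case: Cf.
- move=> y; congr f; rewrite addrC tprojDz// => j.
  by rewrite mxE; exact: natr_int.
Qed.

End torus_calculus.

(** A C^1 field [(rho, W)] without space-time divergence is orthogonal to
    every space-time gradient. *)
Lemma divergence_free_weak (R : realType) (d : nat)
    (rho : torus R d.+1 -> R) (W : 'I_d -> torus R d.+1 -> R)
    (phi : torus R d.+1 -> R) :
  torus_C 1 rho -> (forall i, torus_C 1 (W i)) ->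
  (forall z, dt rho z + \sum_i pderiv (lift ord_max i) (W i) z = 0) ->
  torus_C 1 phi ->
  (\int[torus_measure R d.+1]_z
     (rho z * dt phi z + \sum_i W i z * gradx phi z 0 i)%:E = 0)%E.
Proof.
move=> Crho CW div0 Cphi.
have E z : rho z * dt phi z + \sum_i W i z * gradx phi z 0 i =
    dt (fun z => rho z * phi z) z +
    \sum_i pderiv (lift ord_max i) (fun z => W i z * phi z) z.
  rewrite /dt pderivM// -/(dt phi z) -/(dt rho z).
  under [in RHS]eq_bigr do rewrite pderivM//.
  rewrite big_split/= -mulr_sumr addrACA -mulrDr div0 mulr0 addr0.
  by under eq_bigr do rewrite mxE.
under eq_integral do rewrite E EFinD -sumEFin.
have ci i (f : torus R d.+1 -> R) : torus_C 1 f ->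
    (torus_measure R d.+1).-integrable setT (EFin \o pderiv i f).
  by move=> /(pderiv_C i)/torus_C_continuous; exact: torus_integrable.
rewrite integralD//=; last 2 first.
- by apply: ci; exact: torus_C1M.
- by apply: integrable_sum => // i _; apply: ci; exact: torus_C1M.
rewrite torus_integral_pderiv ?add0e; last exact: torus_C1M.
rewrite integral_sum//=; last by move=> i; apply: ci; exact: torus_C1M.
by apply: big1 => i _; apply: torus_integral_pderiv; exact: torus_C1M.
Qed.

(** * Legendre duality *)

Section dot_product.
Context {R : realType} {d : nat}.
Implicit Types p q v : 'rV[R]_d.

Lemma dotvBl p q v : dotv (p - q) v = dotv p v - dotv q v.
Proof.
by rewrite /dotv -sumrB; apply: eq_bigr => i _; rewrite !mxE mulrBl.
Qed.

Lemma dotv0r p : dotv p 0 = 0.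
Proof. by apply: big1 => i _; rewrite mxE mulr0. Qed.

Lemma dotv_line t i p v : dotv (t *: delta_mx 0 i + p) v = t * v 0 i + dotv p v.
Proof.
rewrite /dotv; under eq_bigr do rewrite rV_lineE mulrDl -mulrA.
rewrite big_split/= -mulr_sumr (bigD1 i)//= eqxx mul1r big1 ?addr0// => j ji.
by rewrite (negbTE ji) mul0r.
Qed.

Lemma normr_coord_le_enorm v i : `|v 0 i| <= enorm v.
Proof.
rewrite -sqrtr_sqr /enorm ler_wsqrtr// /dotv (bigD1 i)//= -expr2 lerDl.
by apply: sumr_ge0 => j _; rewrite -expr2 sqr_ge0.
Qed.

Lemma enorm_ge0 v : 0 <= enorm v.
Proof. exact: sqrtr_ge0. Qed.

Lemma normr_dotv_le p v : `|dotv p v| <= (\sum_i `|p 0 i|) * enorm v.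
Proof.
rewrite mulr_suml (le_trans (ler_norm_sum _ _ _))//; apply: ler_sum => i _.
by rewrite normrM ler_wpM2l//; exact: normr_coord_le_enorm.
Qed.

Lemma continuous_dotv p : continuous (dotv p).
Proof.
apply: continuous_sum => i.
by apply: continuous_mul; [exact: cst_continuous|exact: coord_continuous].
Qed.

(** Superlinearity confines the supremum to a cube. *)
Lemma superlinear_sup_attained (f : 'rV[R]_d -> R) p :
  continuous f -> superlinear f ->
  exists v, forall w, dotv p w - f w <= dotv p v - f v.
Proof.
move=> cf supf; pose g v := dotv p v - f v.
have [r fr] := supf (\sum_i `|p 0 i| + 1).
pose r' := Num.max r `|f 0|.
have far v : r' < enorm v -> g v <= g 0.
  rewrite /r' gt_max => /andP[rv f0v].
  have v0 : 0 < enorm v := le_lt_trans (normr_ge0 _) f0v.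
  have := fr v rv; rewrite ltr_pdivlMr// mulrDl mul1r => fv.
  have := le_trans (ler_norm _) (normr_dotv_le p v); have := ler_norm (f 0).
  by rewrite /g dotv0r; lra.
pose K := [set v : 'rV[R]_d | forall i, `[- r', r']%classic (v ord0 i)].
have cK : compact K.
  exact: (@rV_compact R d (fun=> `[- r', r']%classic) (fun=> @segment_compact R _ _)).
have r'0 : 0 <= r' by rewrite /r' le_max normr_ge0 orbT.
have K0 : K 0 by move=> i; rewrite /= mxE in_itv/= oppr_le0 r'0.
have cg : continuous g.
  by move=> v; exact: (cvgB (@continuous_dotv p v) (cf v)).
have [||v _ gv] := @EVT_max_rV R d g K _ cK.
- by exists 0.
- exact: continuous_subspaceT.
exists v => w; have [Kw|] := pselect (K w); first by apply: gv; rewrite inE.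
move=> /existsNP[i] /= /negP; rewrite in_itv/= -ler_norml -ltNge => r'w.
apply: le_trans (far w (lt_le_trans r'w (normr_coord_le_enorm _ _))) _.
by apply: gv; rewrite inE.
Qed.

End dot_product.

Section legendre.
Context {R : realType} {d : nat}.
Local Notation space := (torus R d.+1).
Local Notation phase := (torus R d.+1 * 'rV[R]_d)%type.
Variables L H : phase -> R.
Hypothesis L_C2 : phase_C 2 L.
Hypothesis L_superlinear : forall z, superlinear (fun v => L (z, v)).
Hypothesis HL : forall zp, (H zp)%:E = legendre L zp.
Hypothesis H_C1 : phase_C 1 H.

Lemma phase_C_continuous k (F : phase -> R) : phase_C k F -> continuous F.
Proof. by move=> CF; apply: phase_continuous; exact: is_C_continuous CF. Qed.

Lemma fenchel_ineq z p v : dotv p v - L (z, v) <= H (z, p).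
Proof.
by rewrite -lee_fin HL; apply: ereal_sup_ubound; exists v.
Qed.

(** A derivative in the velocity variable is the derivative of the lift along a
    vertical direction, and so inherits its regularity jointly in both
    variables. *)
Lemma is_derive_phase (F : phase -> R) y p i : phase_C 1 F ->
  is_derive p (delta_mx 0 i) (fun p => F (tproj y, p))
    ('D_(0, delta_mx 0 i) (fun x => F (tproj x.1, x.2)) (y, p)).
Proof.
move=> [dF _].
apply: (@is_derive_line _ _ _ _ (fun x => F (tproj x.1, x.2))
  (fun p => (y, p)) _ _ (0, delta_mx 0 i)).
  move=> h; rewrite -[RHS]/(h *: (0 : 'rV[R]_d.+1) + y, h *: delta_mx 0 i + p).
  by rewrite scaler0 add0r.
by apply: DeriveDef => //; exact: diff_derivable.
Qed.

Lemma Hp_tproj y p i : Hp H (tproj y) p 0 i =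
  'D_(0, delta_mx 0 i) (fun x => H (tproj x.1, x.2)) (y, p).
Proof.
by rewrite mxE; have /@derive_val := is_derive_phase y p i H_C1.
Qed.

(** [Hp z p] is where the supremum defining [H (z, p)] is attained: the
    tangent inequality at a maximizer [v] makes [v] a subgradient of the
    differentiable function [H (z, _)]. *)
Lemma fenchel_eq z p : H (z, p) = dotv p (Hp H z p) - L (z, Hp H z p).
Proof.
have cL : continuous (fun v => L (z, v)).
  move=> v; apply: (@continuous_comp _ _ _ (pair z) L).
    apply: continuous_pair; first exact: cst_continuous.
    by move=> x; exact: cvg_id.
  exact: (phase_C_continuous L_C2).
have [v vmax] := superlinear_sup_attained p cL (L_superlinear z).
have Hv : H (z, p) = dotv p v - L (z, v).
  apply/eqP; rewrite eq_le fenchel_ineq andbT -lee_fin HL.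
  by apply: ge_ereal_sup => _ [w _ <-]; rewrite lee_fin.
suff -> : Hp H z p = v by [].
apply/rowP => i; rewrite mxE.
pose f (t : R) := H (z, t *: delta_mx 0 i + p) - t * v 0 i.
have df (t : R) : is_derive t 1 f
    (grad (fun p => H (z, p)) (t *: delta_mx 0 i + p) 0 i - v 0 i).
  have dH : is_derive (t *: delta_mx 0 i + p) (delta_mx 0 i)
      (fun p => H (z, p)) (grad (fun p => H (z, p)) (t *: delta_mx 0 i + p) 0 i).
    rewrite mxE -(tproj_repr z); apply: derivableP.
    by have [] := is_derive_phase (repr z) (t *: delta_mx 0 i + p) i H_C1.
  have dHl : is_derive t 1 (fun t : R => H (z, t *: delta_mx 0 i + p))
      (grad (fun p => H (z, p)) (t *: delta_mx 0 i + p) 0 i).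
    apply: (@is_derive_line _ _ _ _ (fun p => H (z, p))
      (fun t : R => t *: delta_mx 0 i + p) t 1 (delta_mx 0 i)) => h.
    by rewrite [h *: 1]mulr1 scalerDl addrA.
  by apply: is_derive_eq; rewrite scaler0 add0r [_ *: 1]mulr1.
(* By the Fenchel inequality at [v], [f] is minimal at [0]. *)
have : is_derive (0 : R) 1 f 0.
  apply: (@derive1_at_min _ f (-1) 1 0) => //.
  - by rewrite in_itv/= ltrN10 ltr01.
  - move=> t _; rewrite /f scale0r add0r mul0r subr0 Hv lerBrDr.
    by have := fenchel_ineq z (t *: delta_mx 0 i + p) v; rewrite dotv_line; lra.
move=> /@derive_val; rewrite (@derive_val _ _ _ _ _ _ _ (df 0)).
by rewrite scale0r add0r mxE => /eqP; rewrite subr_eq0 => /eqP.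
Qed.

Lemma H_tangent z p q : H (z, p) + dotv (q - p) (Hp H z p) <= H (z, q).
Proof.
have := fenchel_ineq z q (Hp H z p); rewrite (fenchel_eq z p) dotvBl; lra.
Qed.

End legendre.

(** * The current carried by a solution *)

Section current.
Context {R : realType} {d : nat}.
Local Notation space := (torus R d.+1).
Local Notation phase := (torus R d.+1 * 'rV[R]_d)%type.
Variables (H : phase -> R) (k : nat).
Implicit Types u : space -> R.

Lemma gradxE u z i : gradx u z 0 i = pderiv (lift ord_max i) u z.
Proof. by rewrite mxE. Qed.

Lemma continuous_dt u : torus_C 1 u -> continuous (dt u).
Proof. by move=> /(pderiv_C ord_max)/torus_C_continuous. Qed.

Lemma continuous_gradx u : torus_C 1 u -> continuous (gradx u).
Proof.
move=> Cu; apply: continuous_row => i.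
under eq_fun do rewrite gradxE.
exact: (torus_C_continuous (pderiv_C _ Cu)).
Qed.

Lemma continuous_along_gradx (T : topologicalType) (F : phase -> T) u :
  continuous F -> torus_C 1 u -> continuous (fun z => F (z, gradx u z)).
Proof.
move=> cF Cu z; apply: (@continuous_comp _ _ _ (fun z => (z, gradx u z)) F).
  apply: continuous_pair; first by move=> x; exact: cvg_id.
  exact: continuous_gradx.
exact: cF.
Qed.

Lemma continuous_expH u : continuous H -> torus_C 1 u -> continuous (expH H k u).
Proof.
move=> cH Cu.
have c : continuous (fun z => k%:R * (dt u z + H (z, gradx u z))).
  apply: continuous_mul; first exact: cst_continuous.
  apply: continuous_add; first exact: continuous_dt.
  exact: continuous_along_gradx.
by move=> z; apply: continuous_comp (c z) _; exact: continuous_expR.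
Qed.

Lemma expH_gt0 u z : 0 < expH H k u z.
Proof. exact: expR_gt0. Qed.

Lemma continuous_Hp_gradx u : phase_C 1 H -> torus_C 1 u ->
  continuous (fun z => Hp H z (gradx u z)).
Proof.
move=> CH Cu; apply: continuous_row => i; apply: torus_continuous.
rewrite /comp/=; under eq_fun do rewrite (Hp_tproj CH).
have cg : continuous (fun y => (y, gradx u (tproj y))).
  apply: continuous_pair; first by move=> x; exact: cvg_id.
  move=> x; apply: (@continuous_comp _ _ _ tproj (gradx u)).
    exact: tproj_continuous.
  exact: continuous_gradx.
move=> y; apply: (@continuous_comp _ _ _ (fun y => (y, gradx u (tproj y)))
  ('D_(0, delta_mx 0 i) (fun x => H (tproj x.1, x.2)))); first exact: cg.
by case: CH => _; exact.
Qed.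

Lemma is_C1_gradx u i : torus_C 2 u ->
  is_C 1 (fun y => gradx u (tproj y) 0 i).
Proof.
by move=> Cu; under eq_fun do rewrite gradxE; exact: (pderiv_C _ Cu).
Qed.

Lemma phase_CW j (F : phase -> R) : phase_C j.+1 F -> phase_C j F.
Proof. exact: is_CW. Qed.

Lemma torus_C1_expH u : phase_C 1 H -> torus_C 2 u -> torus_C 1 (expH H k u).
Proof.
move=> CH Cu; apply: is_C1_expR; apply: is_C1M; first exact: is_C1_cst.
apply: is_C1D; first exact: (pderiv_C ord_max Cu).
apply: (@is_C1_comp _ _ _ (fun x => H (tproj x.1, x.2)) (fun y => gradx u (tproj y))) => //.
by move=> i; exact: is_C1_gradx.
Qed.

Lemma torus_C1_Hp_gradx u i : phase_C 2 H -> torus_C 2 u ->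
  torus_C 1 (fun z => Hp H z (gradx u z) 0 i).
Proof.
move=> CH Cu; rewrite /torus_C /comp.
under eq_fun do rewrite (Hp_tproj (phase_CW CH)).
apply: (@is_C1_comp _ _ _ ('D_(0, delta_mx 0 i) (fun x => H (tproj x.1, x.2)))
  (fun y => gradx u (tproj y))).
  by case: CH => _; exact.
by move=> j; exact: is_C1_gradx.
Qed.

(** The equation says that the space-time current is divergence free. *)
Lemma current_weak u phi : phase_C 2 H -> torus_C 2 u ->
  (forall z, dt (expH H k u) z
     + divx (fun y => expH H k u y *: Hp H y (gradx u y)) z = 0) ->
  torus_C 1 phi ->
  (\int[torus_measure R d.+1]_z (expH H k u z *
    (dt phi z + dotv (gradx phi z) (Hp H z (gradx u z))))%:E = 0)%E.
Proof.
move=> CH Cu eqn Cphi.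
have CH1 : phase_C 1 H by exact: phase_CW.
have Crho := torus_C1_expH CH1 Cu.
pose W i z := expH H k u z * Hp H z (gradx u z) 0 i.
have CW i : torus_C 1 (W i) by apply: torus_C1M => //; exact: torus_C1_Hp_gradx.
rewrite -(divergence_free_weak Crho CW _ Cphi).
  apply: eq_integral => z _; congr (_%:E).
  rewrite mulrDr mulr_sumr; congr (_ + _).
  by apply: eq_bigr => i _; rewrite /W -mulrA [X in _ * X = _]mulrC.
move=> z; rewrite -[RHS](eqn z); congr (_ + _); apply: eq_bigr => i _.
by congr (pderiv _ _ _); apply/funext => y; rewrite [RHS]mxE.
Qed.

End current.

(** * Densities and entropy *)

(** Both integrals may be infinite here, whence the comparison of positive and
    negative parts. *)
Lemma ge_integral d (T : measurableType d) (R : realType)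
    (mu : {measure set T -> \bar R}) (f g : T -> \bar R) :
  measurable_fun setT f -> measurable_fun setT g -> (forall x, f x <= g x)%E ->
  (\int[mu]_x f x <= \int[mu]_x g x)%E.
Proof.
move=> mf mg fg; rewrite [leLHS]integralE [leRHS]integralE; apply: leeB.
  apply: ge0_le_integral => //; try exact: measurable_funepos.
  by move=> x _; apply: (@funepos_le _ _ setT); rewrite ?inE// => y _; exact: fg.
apply: ge0_le_integral => //; try exact: measurable_funeneg.
by move=> x _; apply: (@funeneg_le _ _ setT); rewrite ?inE// => y _; exact: fg.
Qed.

Lemma le_limn_einf (R : realType) (u v : nat -> \bar R) :
  (forall n, u n <= v n)%E -> (limn_einf u <= limn_einf v)%E.
Proof.
move=> uv; rewrite !limn_einf_lim; apply: lee_lim.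
- exact: is_cvg_einfs.
- exact: is_cvg_einfs.
- apply: nearW => n; apply: le_ereal_inf_tmp => _ [j /= nj <-].
  by apply: le_trans (uv j); apply: ereal_inf_lbound; exists j.
Qed.

(** Convexity of [x |-> x * ln x - x] against its conjugate [expR]. *)
Lemma xlnx_ge (R : realType) (a g : R) : 0 <= a ->
  a * g + a - expR g <= a * ln a.
Proof.
rewrite le_eqVlt => /predU1P[<-|a0].
  by rewrite !mul0r !add0r oppr_le0 expR_ge0.
have := expR_ge1Dx (g - ln a).
rewrite expRB lnK ?posrE// ler_pdivlMr//; lra.
Qed.

Lemma measurable_Radon_Nikodym d (T : measurableType d) (R : realType)
    (P nu : probability T R) : nu `<< P ->
  measurable_fun setT (Radon_Nikodym (charge_of_finite_measure nu) P).
Proof.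
move=> nuP; apply: (@measurable_int _ _ _ P).
exact: Radon_Nikodym_integrable.
Qed.

Section density.
Context d (T : measurableType d) (R : realType) (P : probability T R).
Variable rho : T -> R.
Hypothesis rho0 : forall x, 0 <= rho x.
Hypothesis irho : P.-integrable setT (EFin \o rho).

Let mrho : measurable_fun setT rho.
Proof. by apply/measurable_EFinP; exact: measurable_int irho. Qed.

Lemma density_probability : (\int[P]_x (rho x)%:E = 1)%E ->
  exists nu : probability T R,
    forall A, nu A = (\int[P]_(x in A) (rho x)%:E)%E.
Proof.
move=> rho1; pose m A := (\int[P]_(x in A) (rho x)%:E)%E.
have m0 : m set0 = 0%E by rewrite /m integral_set0.
have m_ge0 A : (0 <= m A)%E by apply: integral_ge0 => x _; rewrite lee_fin.
have m_sigma : semi_sigma_additive m.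
  by apply: semi_sigma_additive_nng_induced => //; exact/measurable_EFinP.
pose mM := isMeasure.Build _ _ _ m m0 m_ge0 m_sigma.
pose mu : {measure set T -> \bar R} := HB.pack m mM.
pose muP := Measure_isProbability.Build _ _ _ mu rho1.
by exists (HB.pack_for (probability T R) m mM muP).
Qed.

Variable nu : probability T R.
Hypothesis nuE : forall A, nu A = (\int[P]_(x in A) (rho x)%:E)%E.

Lemma density_dominates : nu `<< P.
Proof.
apply/null_content_dominatesP => A mA PA0; rewrite nuE.
by apply: null_set_integral => //; apply/measurable_EFinP; exact: measurable_funTS.
Qed.

Lemma Radon_Nikodym_density :
  ae_eq P setT (Radon_Nikodym (charge_of_finite_measure nu) P) (EFin \o rho).
Proof.
have nuP := density_dominates.
apply: integral_ae_eq => //.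
- exact: Radon_Nikodym_integrable.
- exact/measurable_EFinP.
- by move=> A _ mA; rewrite -Radon_Nikodym_integral//; exact: nuE.
Qed.

Lemma integral_density (f : T -> R) : nu.-integrable setT (EFin \o f) ->
  (\int[nu]_x (f x)%:E = \int[P]_x (f x * rho x)%:E)%E.
Proof.
move=> intf; have mf := measurable_int _ intf.
rewrite -(Radon_Nikodym_change_of_variables density_dominates measurableT intf).
under [RHS]eq_integral do rewrite EFinM.
apply: ae_eq_integral => //.
- apply: emeasurable_funM => //.
  by apply: measurable_Radon_Nikodym; exact: density_dominates.
- by apply: emeasurable_funM => //; exact/measurable_EFinP.
- exact: ae_eqe_mul2l Radon_Nikodym_density.
Qed.

End density.

Section torus_entropy.
Context {R : realType} {n : nat}.
Local Notation pmeasure := (probability (borel (torus R n)) R).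
Local Notation dz := (torus_measure R n).

Lemma measurable_xlnx d (T : measurableType d) (f : T -> R) :
  measurable_fun setT f -> measurable_fun setT (fun x => (f x * ln (f x))%:E).
Proof.
move=> mf; apply/measurable_EFinP; apply: measurable_funM => //.
exact: measurableT_comp.
Qed.

Lemma entropy_density (rho : torus R n -> R) (nu : pmeasure) :
  (forall z, 0 <= rho z) -> dz.-integrable setT (EFin \o rho) ->
  (forall A, nu A = (\int[dz]_(z in A) (rho z)%:E)%E) ->
  entropy nu = (\int[dz]_z (rho z * ln (rho z))%:E)%E.
Proof.
move=> rho0 irho nuE; have nudz := density_dominates irho nuE.
rewrite /entropy; apply: ae_eq_integral => //.
- by apply: measurable_xlnx; exact: measurableT_comp.
- by apply: measurable_xlnx; apply/measurable_EFinP; exact: measurable_int irho.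
- have := Radon_Nikodym_density irho nuE.
  by apply: filterS => z /= /(_ I) ->.
Qed.

(** Gibbs' inequality, obtained by integrating [xlnx_ge] with [a] the density of
    [m]: the integrals of [a] and of [expR g] are both [1] and cancel. *)
Lemma entropy_ge (m : pmeasure) (g : torus R n -> R) :
  m `<< dz -> continuous g -> (\int[dz]_z (expR (g z))%:E = 1)%E ->
  (\int[m]_z (g z)%:E <= entropy m)%E.
Proof.
move=> mdz cg g1.
(* This version of the density is nonnegative everywhere, as [xlnx_ge]
   requires; it agrees almost everywhere with the one defining the entropy. *)
pose r := Radon_Nikodym_SigmaFinite.f m dz.
have r0 z : (0 <= r z)%E by exact: Radon_Nikodym_SigmaFinite.f_ge0.
have rfin z : r z \is a fin_num by exact: Radon_Nikodym_SigmaFinite.f_fin_num.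
have ir : dz.-integrable setT r by exact: Radon_Nikodym_SigmaFinite.f_integrable.
have rRN := ae_eq_Radon_Nikodym_SigmaFinite mdz measurableT.
have mr := measurable_int _ ir.
have mRN : measurable_fun setT (Radon_Nikodym (charge_of_finite_measure m) dz).
  exact: measurable_Radon_Nikodym.
have -> : entropy m = (\int[dz]_z (fine (r z) * ln (fine (r z)))%:E)%E.
  rewrite /entropy; apply: ae_eq_integral => //.
  - by apply: measurable_xlnx; exact: measurableT_comp.
  - by apply: measurable_xlnx; exact: measurableT_comp.
  by move: rRN; apply: filterS => z /= /(_ I) <-.
have c_expg : continuous (expR \o g).
  by move=> z; apply: continuous_comp; [exact: cg|exact: continuous_expR].
have iexpg : dz.-integrable setT (EFin \o (expR \o g)) by exact: torus_integrable.
have mg := continuous_measurable cg.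
have igm : m.-integrable setT (EFin \o g) by exact: torus_integrable.
have igr : dz.-integrable setT (fun z => (g z)%:E * r z)%E.
  apply: integrableMr => //; have [M gM] := torus_bounded cg.
  exists M; split; first exact: num_real.
  by move=> M' MM' z _; exact: le_trans (gM z) (ltW MM').
have igrE : (\int[dz]_z ((g z)%:E * r z) = \int[m]_z (g z)%:E)%E.
  rewrite -(Radon_Nikodym_change_of_variables mdz measurableT igm).
  apply: ae_eq_integral => //.
  - exact: measurable_int igr.
  - by apply: emeasurable_funM => //; exact/measurable_EFinP.
  - exact: ae_eqe_mul2l.
have r1 : (\int[dz]_z r z = 1)%E.
  by rewrite -(Radon_Nikodym_SigmaFinite.f_integral mdz)//; exact: probability_setT.
apply: (@le_trans _ _ (\int[dz]_z ((g z)%:E * r z + r z - (expR (g z))%:E))%E).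
  rewrite integralB//=; last exact: integrableD.
  by rewrite integralD//= g1 igrE r1 addeK.
apply: ge_integral => [||z].
- apply: emeasurable_funB; first apply: emeasurable_funD => //.
    exact: measurable_int igr.
  exact: measurable_int iexpg.
- by apply: measurable_xlnx; exact: measurableT_comp.
move: (rfin z) (r0 z); case: (r z) => //= a _; rewrite !lee_fin => a0.
by rewrite [g z * a]mulrC; exact: xlnx_ge.
Qed.

(** The lower bound of [entropy_ge] is weakly continuous in the measure, so it
    passes to the relaxation. *)
Lemma entropy_lsc_ge (m : pmeasure) (g : torus R n -> R) :
  continuous g -> (\int[dz]_z (expR (g z))%:E = 1)%E ->
  (\int[m]_z (g z)%:E <= entropy_lsc m)%E.
Proof.
move=> cg g1; apply: le_ereal_inf_tmp => _ [mn [mndz mnm ->]].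
have mng := mnm g cg.
rewrite -(cvg_lim _ mng)// -is_cvg_limn_einfE; last by apply/cvg_ex; eexists; exact: mng.
by apply: le_limn_einf => j; exact: entropy_ge.
Qed.

(** The constant sequence [nu] converges weakly to every measure that has the
    same integrals of continuous functions. *)
Lemma entropy_lsc_le (m nu : pmeasure) :
  nu `<< dz ->
  (forall f : torus R n -> R, continuous f ->
    (\int[nu]_z (f z)%:E = \int[m]_z (f z)%:E)%E) ->
  (entropy_lsc m <= entropy nu)%E.
Proof.
move=> nudz num; apply: ereal_inf_lbound; exists (fun=> nu); split => //.
  by move=> f cf; rewrite (num f cf); exact: cvg_cst.
rewrite is_cvg_limn_einfE; last exact: is_cvg_cst.
by rewrite (cvg_lim _ (cvg_cst _)).
Qed.

End torus_entropy.

(** * Graph measures *)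

Section graph_measure.
Context {R : realType} {d : nat}.
Local Notation space := (torus R d.+1).
Local Notation phase := (torus R d.+1 * 'rV[R]_d)%type.
Local Notation dz := (torus_measure R d.+1).

Lemma continuous_dotv2 (T : topologicalType) (p v : T -> 'rV[R]_d) :
  continuous p -> continuous v -> continuous (fun x => dotv (p x) (v x)).
Proof.
move=> cp cv; apply: continuous_sum => i.
have c (q : T -> 'rV[R]_d) : continuous q -> continuous (fun x => q x 0 i).
  move=> cq x; apply: (@continuous_comp _ _ _ q (fun w => w 0 i)); first exact: cq.
  exact: coord_continuous.
by apply: continuous_mul; exact: c.
Qed.

Lemma continuous_base (f : space -> R) :
  continuous f -> continuous (fun zv : phase => f zv.1).
Proof.
move=> cf zv; apply: (@continuous_comp _ _ _ fst f); first exact: cvg_fst.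
exact: cf.
Qed.

Lemma continuous_transport (phi : space -> R) : torus_C 1 phi ->
  continuous (fun zv : phase => dt phi zv.1 + dotv (gradx phi zv.1) zv.2).
Proof.
move=> Cphi; apply: continuous_add.
  by apply: continuous_base; exact: continuous_dt.
apply: continuous_dotv2; last by move=> zv; exact: cvg_snd.
move=> zv; apply: (@continuous_comp _ _ _ fst (gradx phi)); first exact: cvg_fst.
exact: continuous_gradx.
Qed.

Lemma continuous_enorm2 : continuous (fun zv : phase => enorm zv.2).
Proof.
have c2 : continuous (fun zv : phase => zv.2) by move=> zv; exact: cvg_snd.
move=> zv; apply: (@continuous_comp _ _ _ (fun zv : phase => dotv zv.2 zv.2)).
  exact: continuous_dotv2.
exact: sqrt_continuous.
Qed.

Lemma phase_measurable (F : phase -> R) :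
  continuous F -> measurable_fun setT (F : borel phase -> R).
Proof. exact: (@continuous_measurable R phase F). Qed.

Lemma integrable_base (P : probability (borel phase) R) (f : space -> R) :
  continuous f -> P.-integrable setT (fun zv => (f zv.1)%:E).
Proof.
move=> cf; have [M fM] := torus_bounded cf.
apply: (@bounded_integrable _ _ _ P (f \o base) M); last by move=> zv; exact: fM.
exact: phase_measurable (continuous_base cf).
Qed.

Lemma integral_base (P : probability (borel phase) R) (f : space -> R) :
  continuous f ->
  (\int[distribution P base]_z (f z)%:E = \int[P]_zv (f zv.1)%:E)%E.
Proof.
move=> cf; rewrite integral_distribution//; last exact: integrable_base.
by apply/measurable_EFinP; exact: continuous_measurable.
Qed.

Variables (V : space -> 'rV[R]_d) (m : space -> R).
Hypothesis cV : continuous V.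
Hypothesis cm : continuous m.
Hypothesis m0 : forall z, 0 <= m z.
Hypothesis m1 : (\int[dz]_z (m z)%:E = 1)%E.

Let cgraph : continuous (fun z => (z, V z)).
Proof. by apply: continuous_pair => // x; exact: cvg_id. Qed.

Lemma continuous_on_graph (F : phase -> R) :
  continuous F -> continuous (fun z => F (z, V z)).
Proof.
move=> cF z; apply: (@continuous_comp _ _ _ (fun z => (z, V z)) F).
  exact: cgraph.
exact: cF.
Qed.

Lemma density_exists : exists nu : probability (borel space) R,
  forall A, nu A = (\int[dz]_(z in A) (m z)%:E)%E.
Proof. by apply: density_probability => //; exact: torus_integrable. Qed.

(** The graph measure is the image of the measure of density [m] under
    [z |-> (z, V z)]. *)
Lemma graph_measure_exists : exists mu, graph_measure V m mu.
Proof.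
have [nu nuE] := density_exists.
pose g (z : borel space) : borel phase := (z, V z).
have mg : measurable_fun setT g.
  exact: (@continuous_borel space phase _ cgraph).
pose gM := isMeasurableFun.Build _ _ _ _ g mg.
pose gX : {mfun borel space >-> borel phase} := HB.pack g gM.
exists (distribution nu gX) => F cF.
have cFg := continuous_on_graph cF.
have iFg : nu.-integrable setT (EFin \o (fun z => F (z, V z))).
  exact: torus_integrable.
rewrite integral_distribution//; last first.
  by apply/measurable_EFinP; exact: continuous_measurable.
rewrite -(integral_density (torus_integrable _ cm) nuE)//.
Qed.

Variable mu : probability (borel phase) R.
Hypothesis muP : graph_measure V m mu.

Lemma entropy_lsc_graph :
  (entropy_lsc (distribution mu base) <= \int[dz]_z (m z * ln (m z))%:E)%E.
Proof.
have [nu nuE] := density_exists.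
have im : dz.-integrable setT (EFin \o m) by exact: torus_integrable.
have nudz := density_dominates im nuE.
rewrite -(entropy_density m0 im nuE); apply: entropy_lsc_le => //.
move=> f cf; rewrite integral_base// (muP (continuous_base cf)).
by rewrite (integral_density im nuE)//; exact: torus_integrable.
Qed.

Lemma graph_measure_holonomic :
  (forall phi : space -> R, torus_C 1 phi ->
    (\int[dz]_z (m z * (dt phi z + dotv (gradx phi z) (V z)))%:E = 0)%E) ->
  holonomic mu.
Proof.
move=> mV; split.
  rewrite (muP continuous_enorm2).
  have cmV : continuous (fun z => enorm (V z) * m z).
    by apply: continuous_mul => //; exact: continuous_on_graph continuous_enorm2.
  exact: integrable_lty (torus_integrable _ cmV).
move=> phi Cphi.
rewrite (muP (continuous_transport Cphi)) -[RHS](mV phi Cphi).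
by apply: eq_integral => z _; rewrite mulrC.
Qed.

End graph_measure.

(** * Minimality *)

Section minimality.
Context {R : realType} {d : nat}.
Local Notation space := (torus R d.+1).
Local Notation phase := (torus R d.+1 * 'rV[R]_d)%type.
Local Notation dz := (torus_measure R d.+1).
Variables (k : nat) (L H : phase -> R) (u : space -> R).
Hypothesis k_gt0 : (1 <= k)%N.
Hypothesis L_C2 : phase_C 2 L.
Hypothesis L_superlinear : forall z, superlinear (fun v => L (z, v)).
Hypothesis HL : forall zp, (H zp)%:E = legendre L zp.
Hypothesis H_C2 : phase_C 2 H.
Hypothesis u_C2 : torus_C 2 u.
Hypothesis u_eqn : forall z, dt (expH H k u) z
  + divx (fun y => expH H k u y *: Hp H y (gradx u y)) z = 0.

Local Notation V := (fun z => Hp H z (gradx u z)).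
Local Notation I := (I_ H k u).
Local Notation m := (fun z => expH H k u z / I).

Let k0 : 0 < k%:R :> R. Proof. by rewrite ltr0n. Qed.
Let H_C1 : phase_C 1 H. Proof. exact: phase_CW. Qed.
Let u_C1 : torus_C 1 u. Proof. exact: torus_CW. Qed.
Let cH : continuous H. Proof. exact: (phase_C_continuous H_C1). Qed.
Let cL : continuous L. Proof. exact: (phase_C_continuous L_C2). Qed.

Local Notation Z := (fun z => dt u z + H (z, gradx u z)).

Let cZ : continuous Z.
Proof.
by apply: continuous_add; [exact: continuous_dt|exact: continuous_along_gradx].
Qed.

Lemma integral_expH w : torus_C 1 w -> (\int[dz]_z (expH H k w z)%:E = (I_ H k w)%:E)%E.
Proof.
move=> Cw; rewrite /I_ /Rintegral fineK//; apply: integrable_fin_num => //.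
by apply: torus_integrable; exact: continuous_expH.
Qed.

(** The exponential and [H (z, _)] are convex, so that [I_k] lies above its
    linearization at [u], which has no first-order term by the equation. *)
Lemma I_minimal w : torus_C 1 w -> I <= I_ H k w.
Proof.
move=> Cw.
suff : (\int[dz]_z (expH H k u z)%:E <= \int[dz]_z (expH H k w z)%:E)%E.
  by rewrite [leLHS](integral_expH u_C1) [leRHS](integral_expH Cw) lee_fin; exact: id.
pose D (v : space -> R) z := expH H k u z * (dt v z + dotv (gradx v z) (V z)).
have cD v : torus_C 1 v -> continuous (D v).
  move=> Cv; apply: continuous_mul; first exact: continuous_expH.
  apply: continuous_add; first exact: continuous_dt.
  by apply: continuous_dotv2; [exact: continuous_gradx|exact: continuous_Hp_gradx].
have D0 v : torus_C 1 v -> (\int[dz]_z (D v z)%:E = 0)%E.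
  by move=> Cv; exact: current_weak.
have iD v : torus_C 1 v -> dz.-integrable setT (EFin \o D v).
  by move=> Cv; apply: torus_integrable; exact: cD.
have iE v : torus_C 1 v -> dz.-integrable setT (EFin \o expH H k v).
  by move=> Cv; apply: torus_integrable; exact: continuous_expH.
apply: (@le_trans _ _ (\int[dz]_z ((expH H k u z)%:E
    + (k%:R%:E * (D w z)%:E - k%:R%:E * (D u z)%:E)))%E).
  have iZ v : torus_C 1 v -> dz.-integrable setT (fun z => k%:R%:E * (D v z)%:E)%E.
    by move=> Cv; apply: integrableZl => //; exact: iD.
  rewrite integralD//; [|exact: iE|by apply: integrableB => //; exact: iZ].
  rewrite integralB//; [|exact: iZ|exact: iZ].
  rewrite !integralZl//; [|exact: iD|exact: iD].
  by rewrite !D0// !mule0 sube0 adde0.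
apply: ge_integral => [||z].
- apply: emeasurable_funD; first exact: measurable_int (iE _ u_C1).
  apply: emeasurable_funB; apply: emeasurable_funM => //.
    exact: measurable_int (iD _ Cw).
  exact: measurable_int (iD _ u_C1).
- exact: measurable_int (iE _ Cw).
rewrite lee_fin /D /expH.
set a := dt u z + H (z, gradx u z); set b := dt w z + H (z, gradx w z).
have ab : dt w z - dt u z + dotv (gradx w z - gradx u z) (V z) <= b - a.
  by have := H_tangent L_C2 L_superlinear HL H_C1 z (gradx u z) (gradx w z); rewrite /a /b; lra.
rewrite dotvBl in ab.
have -> : k%:R * b = k%:R * a + k%:R * (b - a) by ring.
rewrite expRD.
apply: (@le_trans _ _ (expR (k%:R * a) * (1 + k%:R * (b - a)))); last first.
  by rewrite ler_wpM2l ?expR_ge0// expR_ge1Dx.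
have := ler_wpM2l (ltW k0) ab => {}ab.
have := ler_wpM2l (expR_ge0 (k%:R * a)) ab; lra.
Qed.

Lemma I_gt0 : 0 < I.
Proof.
have [M ZM] := torus_bounded cZ.
apply: (@lt_le_trans _ _ (expR (k%:R * - M))); first exact: expR_gt0.
suff : ((expR (k%:R * - M))%:E <= \int[dz]_z (expH H k u z)%:E)%E.
  by rewrite [leRHS](integral_expH u_C1) lee_fin; exact: id.
rewrite -[leLHS]mule1 -(@probability_setT _ _ _ dz) -integral_cst//.
apply: ge_integral => //.
  exact: measurable_int (torus_integrable dz (continuous_expH cH u_C1)).
move=> z; rewrite lee_fin ler_expR ler_wpM2l ?(ltW k0)//.
by have := ZM z; rewrite ler_norml => /andP[].
Qed.

Let cm : continuous m.
Proof.
apply: continuous_mul; first exact: continuous_expH.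
exact: cst_continuous.
Qed.

Let m_gt0 z : 0 < m z.
Proof. by rewrite divr_gt0// ?I_gt0// expH_gt0. Qed.

Let m1 : (\int[dz]_z (m z)%:E = 1)%E.
Proof.
under eq_integral do rewrite EFinM.
rewrite integralZr//; last by apply: torus_integrable; exact: continuous_expH.
by rewrite (integral_expH u_C1) -EFinM divff// gt_eqF// I_gt0.
Qed.

Let m_weak phi : torus_C 1 phi ->
  (\int[dz]_z (m z * (dt phi z + dotv (gradx phi z) (V z)))%:E = 0)%E.
Proof.
move=> Cphi.
under eq_integral do rewrite mulrAC EFinM.
rewrite integralZr//; last first.
  apply: torus_integrable; apply: continuous_mul; first exact: continuous_expH.
  apply: continuous_add; first exact: continuous_dt.
  by apply: continuous_dotv2; [exact: continuous_gradx|exact: continuous_Hp_gradx].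
by rewrite current_weak// mul0e.
Qed.

Let ln_m z : ln (m z) = k%:R * (dt u z + H (z, gradx u z)) - ln I.
Proof. by rewrite ln_div ?posrE ?expH_gt0 ?I_gt0// /expH expRK. Qed.

Let c_ln : continuous (fun z => ln (m z)).
Proof.
under eq_fun do rewrite ln_m.
apply: continuous_add; last exact: cst_continuous.
by apply: continuous_mul => //; exact: cst_continuous.
Qed.

Let cV : continuous V.
Proof. exact: continuous_Hp_gradx. Qed.

Lemma solution_graph_exists : exists mu, graph_measure V m mu.
Proof. by apply: graph_measure_exists => // z; exact: ltW. Qed.

Lemma solution_graph_holonomic mu : graph_measure V m mu -> holonomic mu.
Proof. by move=> muP; apply: graph_measure_holonomic muP m_weak. Qed.

(** The action lies above [- ln I / k]: the Fenchel inequality bounds the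
    integral of [L], Gibbs' inequality the entropy, and the terms in [u] cancel
    because [mu] is holonomic. *)
Lemma action_ge mu : holonomic mu -> ((- (ln I / k%:R))%:E <= action L k mu)%E.
Proof.
move=> [mu_v mu_hol].
pose Y (zv : phase) := dt u zv.1 + dotv (gradx u zv.1) zv.2.
have iZ := integrable_base mu cZ.
have cY : continuous Y by exact: continuous_transport.
have mY : measurable_fun setT (Y : borel phase -> R).
  exact: phase_measurable.
have iv : mu.-integrable setT (fun zv : borel phase => (enorm zv.2)%:E).
  apply/integrableP; split.
    by apply/measurable_EFinP; exact: phase_measurable (@continuous_enorm2 R d).
  by under eq_integral do rewrite /= ger0_norm ?enorm_ge0//.
have iY : mu.-integrable setT (EFin \o Y).
  (* [Y] grows at most linearly in the velocity, and velocities have a finite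
     first moment. *)
  have [M dtM] := torus_bounded (continuous_dt u_C1).
  have [|C gradC] := @torus_bounded _ _ (fun z => \sum_i `|gradx u z 0 i|).
    apply: continuous_sum => i z.
    apply: (@cvg_norm _ _ _ (nbhs z) _ (fun z => gradx u z 0 i)).
    apply: (@continuous_comp _ _ _ (gradx u) (fun w => w 0 i)).
      exact: continuous_gradx.
    exact: coord_continuous.
  have iMC : mu.-integrable setT (fun zv : borel phase =>
      M%:E + C%:E * (enorm zv.2)%:E)%E.
    apply: integrableD => //; first exact: finite_measure_integrable_cst.
    exact: integrableZl.
  apply: (le_integrable _ _ _ iMC) => //; first exact/measurable_EFinP.
  move=> [z v] _; rewrite /Y /= lee_fin.
  apply: le_trans (ler_normD _ _) _.
  apply: le_trans (ler_norm _); apply: lerD; first exact: dtM.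
  apply: le_trans (normr_dotv_le _ _) _; rewrite ler_wpM2r ?enorm_ge0//.
  exact: le_trans (ler_norm _) (gradC z).
have Y0 : (\int[mu]_zv (Y zv)%:E = 0)%E by exact: mu_hol.
have iL : (- (\int[mu]_zv (Z zv.1)%:E) <= \int[mu]_zv (L zv)%:E)%E.
  rewrite -[leLHS]sub0e -Y0 -integralB//.
  apply: ge_integral => [||[z v]].
  - by apply: emeasurable_funB; [exact: measurable_int iY|exact: measurable_int iZ].
  - by apply/measurable_EFinP; exact: phase_measurable cL.
  rewrite lee_fin /Y/=.
  by have := fenchel_ineq HL z (gradx u z) v; lra.
have expR_ln : (\int[dz]_z (expR (ln (m z)))%:E = 1)%E.
  by rewrite -[RHS]m1; apply: eq_integral => z _; rewrite lnK// posrE.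
have iS : (\int[mu]_zv (Z zv.1)%:E - (ln I / k%:R)%:E <=
    (k%:R^-1)%:E * entropy_lsc (distribution mu base))%E.
  have := entropy_lsc_ge (distribution mu base) c_ln expR_ln.
  rewrite integral_base// => /(lee_wpmul2l (x := (k%:R^-1)%:E)).
  rewrite lee_fin invr_ge0 ltW// => /(_ isT); apply: le_trans.
  rewrite -integralZl//; last exact: integrable_base c_ln.
  rewrite (_ : (\int[mu]_zv _ - _)%E = \int[mu]_zv ((Z zv.1)%:E + (- (ln I / k%:R))%:E))%E.
    rewrite (_ : (fun _ => _) = (fun zv : borel phase =>
      (k%:R^-1)%:E * (ln (m zv.1))%:E)%E)//.
    apply/funext => zv; rewrite -EFinM -EFinD /= ln_m; congr (_%:E).
    by field; rewrite gt_eqF.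
  rewrite integralD//=; last exact: finite_measure_integrable_cst.
  by rewrite integral_cst// [X in (_ * X)%E](_ : _ = 1%E) ?mule1//; exact: probability_setT.
apply: le_trans (leeD iL iS).
have /fineK <- := integrable_fin_num measurableT iZ.
by rewrite -EFinN -EFinB -EFinD lee_fin; lra.
Qed.

(** On the graph of [V] Fenchel's inequality is an equality, and the entropy of
    the base measure is at most that of its density; the current being weakly
    divergence free, the terms in [u] integrate to [0]. *)
Lemma action_graph mu : graph_measure V m mu ->
  (action L k mu <= (- (ln I / k%:R))%:E)%E.
Proof.
move=> muP; rewrite /action (muP L cL).
have k1 : (0 <= (k%:R^-1)%:E :> \bar R)%E by rewrite lee_fin invr_ge0 ltW.
have := entropy_lsc_graph cm (fun z => ltW (m_gt0 z)) m1 muP.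
move=> /(lee_wpmul2l k1) S; apply: le_trans (leeD2l _ S) _.
pose X z := m z * (dt u z + dotv (gradx u z) (V z)).
have cX : continuous X.
  apply: continuous_mul => //; apply: continuous_add; first exact: continuous_dt.
  by apply: continuous_dotv2; [exact: continuous_gradx|exact: cV].
have cLm : continuous (fun z => L (z, V z) * m z).
  by apply: continuous_mul => //; exact: (continuous_on_graph cV cL).
have cmln : continuous (fun z => m z * ln (m z)).
  by apply: continuous_mul.
rewrite -integralZl//; last exact: torus_integrable cmln.
rewrite -integralD//; last 2 first.
- exact: torus_integrable cLm.
- by apply: integrableZl => //; exact: torus_integrable cmln.
have -> : (fun z => (L (z, V z) * m z)%:E + (k%:R^-1)%:E * (m z * ln (m z))%:E)%E =
    (fun z => (X z)%:E + (- (ln I / k%:R))%:E * (m z)%:E)%E.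
  apply/funext => z; rewrite -!EFinM -!EFinD; congr (_%:E).
  rewrite ln_m /X.
  have := fenchel_eq L_C2 L_superlinear HL H_C1 z (gradx u z) => ->.
  by field; rewrite (lt0r_neq0 k0) (lt0r_neq0 I_gt0).
rewrite integralD//=; [|exact: torus_integrable cX|
  by apply: integrableZl => //; exact: torus_integrable cm].
rewrite m_weak// add0e integralZl//; last exact: torus_integrable cm.
by rewrite m1 mule1.
Qed.

End minimality.

Theorem proposition2 (R : realType) (d k : nat)
    (L H : torus R d.+1 * 'rV[R]_d -> R) (u_k : torus R d.+1 -> R) :
  (1 <= k)%N ->
  phase_C 2 L ->
  (forall z, strictly_convex (fun v => L (z, v))) ->
  (forall z, superlinear (fun v => L (z, v))) ->
  (forall zp, (H zp)%:E = legendre L zp) ->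
  (forall j, phase_C j H) ->
  (forall z p, posdef (Hpp H z p)) ->
  (forall z, superlinear (fun p => H (z, p))) ->
  (forall j, torus_C j u_k) ->
  (forall z, dt (expH H k u_k) z
     + divx (fun y => expH H k u_k y *: Hp H y (gradx u_k y)) z = 0) ->
  \int[torus_measure R d.+1]_z u_k z = 0 ->
  let m_k z := expH H k u_k z / I_ H k u_k in
  let V_k z := Hp H z (gradx u_k z) in
  [/\ exists mu_k, graph_measure V_k m_k mu_k,
      forall mu_k, graph_measure V_k m_k mu_k ->
        is_minimizer holonomic (action L k) mu_k &
      is_minimizer C1_mean0 (I_ H k) u_k].
Proof.
move=> k1 CL _ Lsup HL CH _ _ Cu eqn u0 m_k V_k.
have CH2 := CH 2; have Cu2 := Cu 2.
split.
- exact: solution_graph_exists.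
- move=> mu muP; split; first exact: solution_graph_holonomic muP.
  move=> nu nuC; apply: (@le_trans _ _ (- (ln (I_ H k u_k) / k%:R))%:E).
    exact: action_graph muP.
  exact: action_ge.
- split; first by split; [exact: Cu 1|exact: u0].
  by move=> w [Cw _]; exact: (I_minimal k1 CL Lsup HL CH2 Cu2 eqn Cw).
Qed.
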